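(* Let $X$ be an ordered Banach space with a closed generating cone and let $Y$ be a normed space. Then every order to norm bounded linear operator $T:X\to Y$ is continuous.
   Context: All vector spaces are real. An ordered Banach space is a Banach space $X$ that is also an ordered vector space with positive cone $X_+$ (with $X_+\cap(-X_+)=\{0\}$); no compatibility of norm and order is assumed beyond what is stated. The cone is generating if $X=X_+-X_+$, and closed means norm closed. A linear operator $T:X\to Y$ is order to norm bounded if $T[a,b]$ is norm bounded in $Y$ for every order interval $[a,b]=\{x\in X: a\le x\le b\}$. *)

(* Defs.v *)
From HB Require Import structures.
From mathcomp Require Import all_boot all_order all_algebra.
From mathcomp Require Import boolp classical_sets functions reals topology normedtype.

Set Implicit Arguments.
Unset Strict Implicit.
Unset Printing Implicit Defensive.

Import Order.TTheory GRing.Theory Num.Theory.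
Import numFieldNormedType.Exports.

Local Open Scope classical_set_scope.
Local Open Scope ring_scope.

(* The order is an explicit relation because the libraries provide no join of
   ordered vector spaces with normed modules. *)
Record vector_order (R : realType) (X : lmodType R) (le : X -> X -> Prop) :
    Prop := VectorOrder {
  vector_order_refl : forall x, le x x ;
  vector_order_anti : forall x y, le x y -> le y x -> x = y ;
  vector_order_trans : forall x y z, le x y -> le y z -> le x z ;
  vector_order_add : forall x y z, le x y -> le (x + z) (y + z) ;
  vector_order_scale : forall (c : R) x y,
    0 <= c -> le x y -> le (c *: x) (c *: y) }.

Definition positive_cone (R : realType) (X : lmodType R)
    (le : X -> X -> Prop) : set X :=
  [set x | le 0 x].

Definition generating (R : realType) (X : lmodType R) (C : set X) : Prop :=
  [set a - b | a in C & b in C] = setT.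

Definition order_interval (R : realType) (X : lmodType R)
    (le : X -> X -> Prop) (a b : X) : set X :=
  [set x | le a x /\ le x b].

Definition order_to_norm_bounded (R : realType) (X : lmodType R)
    (Y : normedModType R) (le : X -> X -> Prop) (T : X -> Y) : Prop :=
  forall a b : X, bounded_set (T @` order_interval le a b).

(* Main.v *)
(** Klee's and Ando's theorem: by Baire, a closed generating cone [C] of a
    Banach space splits every [x] as a difference of two elements of [C] whose
    norms are at most [M * `|x|], so it suffices to bound [T] on [C].  If [T]
    were unbounded there, some [u n] in [C] with [`|u n| <= 2^-n] would satisfy
    [`|T (u n)| > n]; but all the [u n] lie in the order interval from [0] to
    their sum, on which [T] is bounded. *)

Require Import Defs.
From HB Require Import structures.
From mathcomp Require Import all_boot all_order all_algebra.
From mathcomp Require Import boolp classical_sets functions reals topology normedtype.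
From mathcomp Require Import ring lra sequences.

Set Implicit Arguments.
Unset Strict Implicit.
Unset Printing Implicit Defensive.

Import Order.TTheory GRing.Theory Num.Theory.
Import numFieldNormedType.Exports.

Local Open Scope classical_set_scope.
Local Open Scope ring_scope.

Record convex_cone (R : realType) (X : lmodType R) (C : set X) : Prop :=
  ConvexCone {
    cone0 : C 0 ;
    coneD : forall x y, C x -> C y -> C (x + y) ;
    coneZ : forall (c : R) x, 0 <= c -> C x -> C (c *: x) }.

Lemma positive_cone_convex (R : realType) (X : lmodType R)
    (le : X -> X -> Prop) (Hle : vector_order le) :
  convex_cone (positive_cone le).
Proof.
case: Hle => lexx _ le_trans leD leZ; split.
- exact: lexx.
- move=> x y x0 y0; apply: (le_trans _ y) => //.
  by have := leD _ _ y x0; rewrite add0r.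
- by move=> c x c0 x0; have := leZ _ _ _ c0 x0; rewrite scaler0.
Qed.

Lemma cone_sum (R : realType) (X : lmodType R) (C : set X) (I : eqType)
    (r : seq I) (P : pred I) (u : I -> X) :
  convex_cone C -> (forall i, C (u i)) -> C (\sum_(i <- r | P i) u i).
Proof. by move=> [C0 CD _] Cu; elim/big_ind: _. Qed.

(** Comparison with a geometric series of sum [2 * M] gives absolute convergence, and closedness
    keeps the limits in [C]. When [C] is a positive cone, the last clause says that the sum
    dominates every term. *)
Lemma cone_geometric_series (R : realType) (X : completeNormedModType R)
    (C : set X) (u : X^nat) (M : R) :
    convex_cone C -> closed C -> (forall n, C (u n)) ->
    (forall n, `|u n| <= M / 2 ^+ n) ->
  exists s, [/\ series u @ \oo --> s, C s, `|s| <= 2 * M &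
                forall n, C (s - u n)].
Proof.
move=> cC clC Cu ubu.
have geoE : geometric M 2^-1 = (fun n => M / 2 ^+ n).
  by apply/funext => n; rewrite /geometric /= exprVn.
have half_lt1 : `|2^-1 : R| < 1 by rewrite ger0_norm; lra.
have cvgM := @cvg_geometric_series _ M _ half_lt1.
have limM : M * (1 - 2^-1)^-1 = 2 * M by field.
rewrite geoE limM in cvgM.
have ncvg : cvgn [normed series u].
  apply: series_le_cvg (cvgP _ cvgM) => // n; first exact: normr_ge0.
  exact: le_trans (normr_ge0 _) (ubu n).
have cvgu := normed_cvg ncvg.
exists (limn (series u)); split => //.
- apply: (@closed_cvg _ _ _ _ (series u) C clC _ _ cvgu).
  by apply: nearW => n; exact: cone_sum.
- apply: le_trans (lim_series_norm ncvg) _.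
  rewrite -(cvg_lim _ cvgM) //; apply: lim_series_le => //.
  exact: cvgP cvgM.
- move=> n.
  have cvgB : series u m - u n @[m --> \oo] --> limn (series u) - u n.
    by apply: cvgB => //; exact: cvg_cst.
  (* A partial sum contains the term [u n] only from [m = n.+1] on; removing it then leaves a sum of
     elements of [C]. *)
  apply: (@closed_cvg _ _ _ _ _ C clC _ _ cvgB); exists n.+1 => // m /= nm.
  rewrite /series /= big_mkord (bigD1 (Ordinal nm)) //= addrAC subrr add0r.
  exact: cone_sum.
Qed.

Definition bounded_differences (R : realType) (X : normedModType R)
    (C : set X) (r : R) : set X :=
  [set x | exists a b, [/\ C a, C b, `|a| <= r, `|b| <= r & x = a - b]].

(** As [C] is generating, these closures cover [X] as [n] grows. Their open complements thus have
    empty intersection, and by Baire one of them is not dense. *)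
Lemma closure_bounded_differences_ball (R : realType)
    (X : completeNormedModType R) (C : set X) :
    generating C ->
  exists (n : nat) x0 (r : R), 0 < r /\
    ball x0 r `<=` closure (bounded_differences C n%:R).
Proof.
move=> genC; pose O n := ~` closure (bounded_differences C n%:R).
have openO n : open (O n) by exact/closed_openC/closed_closure.
have [n ndO] : exists n, ~ dense (O n).
  apply/existsNP => dO.
  have dense_cap : dense (\bigcap_n O n).
    by apply: Baire => n; split.
  have [|x [_ Ox]] := dense_cap setT _ openT; first by exists 0.
  have : [set a - b | a in C & b in C] x by rewrite genC.
  move=> [a Ca [b Cb abx]].
  have [n ltn] : exists n : nat, `|a| + `|b| < n%:R :> R.
    by exists (Num.bound (`|a| + `|b|)); rewrite archi_boundP // addr_ge0.
  apply: (Ox n I); apply: subset_closure; exists a, b; split => //.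
  - by have := normr_ge0 b; lra.
  - by have := normr_ge0 a; lra.
have [U [[x0 [oU Ux0]] UO]] := denseNE ndO.
have /nbhs_ballP[r /= r0 xrU] : nbhs x0 U by apply: open_nbhs_nbhs.
exists n, x0, r; split => // x /xrU Ux; apply: contrapT => nx.
by have : (U `&` O n) x by []; rewrite UO.
Qed.

(** The ball found by Baire is moved to the origin, using that differences of cone elements are
    stable under sums and negation, and is then rescaled. The closure costs the relative error one
    half. *)
Lemma generating_approx (R : realType) (X : completeNormedModType R)
    (C : set X) :
    convex_cone C -> generating C ->
  exists2 M : R, 0 <= M & forall x, exists a b,
    [/\ C a, C b, `|a| <= M * `|x|, `|b| <= M * `|x| &
        `|x - (a - b)| <= `|x| / 2].
Proof.
move=> cC genC.
have [n [x0 [r [r0 ballK]]]] := closure_bounded_differences_ball genC.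
exists (n%:R * (2 / r)); first by rewrite mulr_ge0 // divr_ge0 // ltW.
move=> x; have [->|x_neq0] := eqVneq x 0.
  exists 0, 0; have C0 := cone0 cC.
  by split; rewrite // ?subr0 ?normr0 ?mulr0 ?mul0r.
have nx0 : 0 < `|x| by rewrite normr_gt0.
(* Chosen so that [x = c *: y] with [y] of norm [r / 2], which puts both [x0 + y] and [x0 - y]
   inside the ball. *)
pose c := 2 / r * `|x|.
have c0 : 0 < c by rewrite mulr_gt0 // divr_gt0.
pose y := c^-1 *: x.
have ny : `|y| = r / 2.
  rewrite normrZ gtr0_norm ?invr_gt0 // /c.
  by field; rewrite !gt_eqF.
(* Two errors below [r / 4], scaled by [c / 2], add up to at most [c * r / 4], which is half the
   norm of [x]. *)
have approx z : `|z| = r / 2 -> exists a b,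
    [/\ C a, C b, `|a| <= n%:R, `|b| <= n%:R & `|x0 + z - (a - b)| < r / 4].
  move=> nz.
  have /ballK cl : ball x0 r (x0 + z).
    by rewrite -ball_normE /= opprD addNKr normrN nz; lra.
  have r4 : 0 < r / 4 by lra.
  have [w [[a [b [Ca Cb an bn ->]]]]] := cl _ (nbhsx_ballx (x0 + z) _ r4).
  by rewrite -ball_normE /= => wz; exists a, b.
(* Averaging approximations of [x0 + y] and [-(x0 - y)] gets rid of [x0]. *)
have [a1 [b1 [Ca1 Cb1 a1n b1n ap1]]] := approx y ny.
have [|a2 [b2 [Ca2 Cb2 a2n b2n ap2]]] := approx (- y).
  by rewrite normrN.
have c20 : 0 <= c / 2 by lra.
have bnd u v : `|u| <= n%:R -> `|v| <= n%:R ->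
    `|(c / 2) *: (u + v)| <= n%:R * (2 / r) * `|x|.
  move=> un vn; rewrite normrZ ger0_norm // -mulrA -/c.
  have := ler_normD u v => uv.
  have -> : n%:R * c = c / 2 * (n%:R + n%:R) by field.
  by apply: ler_wpM2l => //; lra.
exists ((c / 2) *: (a1 + b2)), ((c / 2) *: (b1 + a2)); split.
- by apply: (coneZ cC) => //; exact: (coneD cC).
- by apply: (coneZ cC) => //; exact: (coneD cC).
- exact: bnd.
- exact: bnd.
have -> : x - ((c / 2) *: (a1 + b2) - (c / 2) *: (b1 + a2)) =
    (c / 2) *: ((x0 + y - (a1 - b1)) - (x0 - y - (a2 - b2))).
  have -> : x = (c / 2) *: (y + y).
    rewrite -scalerDl scalerA (_ : c / 2 * _ = 1) ?scale1r //.
    by field; rewrite gt_eqF.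
  rewrite -!scalerBr; congr (_ *: _).
  have -> : a1 + b2 - (b1 + a2) = (a1 - b1) - (a2 - b2).
    by rewrite opprD addrACA opprB.
  rewrite opprD (opprD (x0 - y)) [RHS]addrACA; congr (_ + _).
  by rewrite opprB [x0 + y]addrC -addrA [x0 + _]addrC subrK.
rewrite normrZ ger0_norm //.
have le2 := ler_normB (x0 + y - (a1 - b1)) (x0 - y - (a2 - b2)).
have -> : `|x| / 2 = c / 2 * (r / 2).
  by rewrite /c; field; rewrite gt_eqF.
by apply: ler_wpM2l => //; lra.
Qed.

(** Approximating the successive remainders halves them each time, so the corrections form two
    geometrically bounded series in [C], whose sums give an exact decomposition. *)
Lemma closed_generating_decomposition (R : realType)
    (X : completeNormedModType R) (C : set X) :
    convex_cone C -> closed C -> generating C ->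
  exists2 M : R, 0 <= M & forall x, exists a b,
    [/\ C a, C b, `|a| <= M * `|x|, `|b| <= M * `|x| & x = a - b].
Proof.
move=> cC clC genC; have [M M0 apx] := generating_approx cC genC.
have /choice[f fP] : forall x, exists p : X * X,
    [/\ C p.1, C p.2, `|p.1| <= M * `|x|, `|p.2| <= M * `|x| &
        `|x - (p.1 - p.2)| <= `|x| / 2].
  by move=> x; have [a [b ?]] := apx x; exists (a, b).
exists (2 * M); first by lra.
move=> x; pose res n := iter n (fun z => z - ((f z).1 - (f z).2)) x.
have res_le n : `|res n| <= `|x| / 2 ^+ n.
  elim: n => [|n IHn]; first by rewrite expr0 divr1.
  rewrite /res iterS -/(res n); have [_ _ _ _ h] := fP (res n).
  apply: (le_trans h); rewrite exprSr invfM mulrA.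
  by rewrite ler_wpM2r // invr_ge0.
have term_le n z : `|z| <= M * `|res n| -> `|z| <= M * `|x| / 2 ^+ n.
  by move=> /le_trans; apply; rewrite -mulrA ler_wpM2l.
pose a n := (f (res n)).1; pose b n := (f (res n)).2.
have [||sa [cva Csa sale _]] :=
    @cone_geometric_series _ _ C a (M * `|x|) cC clC.
- by move=> n; have [] := fP (res n).
- by move=> n; apply: term_le; have [] := fP (res n).
have [||sb [cvb Csb sble _]] :=
    @cone_geometric_series _ _ C b (M * `|x|) cC clC.
- by move=> n; have [] := fP (res n).
- by move=> n; apply: term_le; have [] := fP (res n).
exists sa, sb; rewrite -!mulrA; split => //.
(* Telescoping: [series a n] and [series b n] collect exactly the first [n] corrections. Hence [res]
   tends to [x - (sa - sb)] as well as to 0. *)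
have resE n : res n = x - (series a n - series b n).
  elim: n => [|n IHn]; first by rewrite /series /= !big_geq // !subr0.
  rewrite /res iterS -/(res n) {1}IHn -/(a n) -/(b n) /series /= !big_nat_recr //=.
  by rewrite -addrA -opprD addrACA -opprD.
have res_cvg0 : res @ \oo --> (0 : X).
  apply/norm_cvg0P.
  have geo0 : `|x| / 2 ^+ n @[n --> \oo] --> (0 : R).
    have -> : (fun n => `|x| / 2 ^+ n) = geometric `|x| 2^-1.
      by apply/funext => n; rewrite /geometric /= exprVn.
    by apply: cvg_geometric; rewrite ger0_norm; lra.
  apply: (squeeze_cvgr _ (cvg_cst 0) geo0).
  by apply: nearW => n; rewrite normr_ge0 res_le.
have res_cvg : res @ \oo --> x - (sa - sb).
  have -> : res = (fun n => x - (series a n - series b n)).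
    by apply/funext.
  by apply: cvgB; [exact: cvg_cst | exact: cvgB].
by apply/eqP; rewrite -subr_eq0; apply/eqP; apply: cvg_unique res_cvg res_cvg0.
Qed.

Lemma order_to_norm_bounded_on_cone (R : realType)
    (X : completeNormedModType R) (le : X -> X -> Prop)
    (Y : normedModType R) (T : {linear X -> Y}) :
    vector_order le -> closed (positive_cone le) ->
    order_to_norm_bounded le T ->
  exists2 L : R, 0 <= L & forall x, positive_cone le x -> `|T x| <= L * `|x|.
Proof.
move=> Hle clC Tb; have cC := positive_cone_convex Hle.
apply: contrapT => unbounded.
have /choice[u uP] : forall n : nat, exists u,
    [/\ positive_cone le u, `|u| <= 1 / 2 ^+ n & n%:R < `|T u|].
  move=> n.
  have [x [Cx Tx]] : exists x,
      positive_cone le x /\ n%:R * 2 ^+ n * `|x| < `|T x|.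
    (* With this constant, rescaling [x] to norm [2 ^- n] leaves an image of norm above [n]. *)
    apply: contrapT => nex; apply: unbounded; exists (n%:R * 2 ^+ n).
      by rewrite mulr_ge0 // exprn_ge0.
    move=> x Cx; rewrite leNgt; apply/negP => lt_Tx.
    by apply: nex; exists x.
  have nx0 : 0 < `|x|.
    rewrite normr_gt0; apply/eqP => x0.
    by move: Tx; rewrite x0 linear0 !normr0 mulr0 ltxx.
  have p0 : 0 < 2 ^+ n :> R by rewrite exprn_gt0.
  have c0 : 0 < (2 ^+ n * `|x|)^-1 by rewrite invr_gt0 mulr_gt0.
  exists ((2 ^+ n * `|x|)^-1 *: x); split.
  - by apply: (coneZ cC) => //; exact: ltW.
  - rewrite normrZ gtr0_norm // invfM -mulrA mulVf ?gt_eqF //.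
    by rewrite mulr1 mul1r.
  - by rewrite linearZ normrZ gtr0_norm // ltr_pdivlMl ?mulr_gt0 // mulrC mulrA.
have [||s [_ _ _ su]] :=
    @cone_geometric_series _ _ _ u 1 cC clC.
- by move=> n; have [] := uP n.
- by move=> n; have [] := uP n.
(* [bounded_set] provides bounds only strictly above its threshold [B], hence [B + 1]. *)
have [B [_ /(_ (B + 1))]] := Tb 0 s.
rewrite ltrDl ltr01 => /(_ isT) TB.
have [n nB] : exists n : nat, B + 1 < n%:R.
  exists (Num.bound `|B + 1|); apply: le_lt_trans (ler_norm _) _.
  exact: archi_boundP.
have [Cun _ nTu] := uP n.
have : `|T (u n)| <= B + 1.
  apply: TB; exists (u n) => //; split => //.
  have := vector_order_add Hle (u n) (su n).
  by rewrite add0r subrK.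
by lra.
Qed.

Theorem corollary2p9 (R : realType) (X : completeNormedModType R)
    (le : X -> X -> Prop) (Hle : vector_order le)
    (Hclosed : closed (positive_cone le))
    (Hgen : generating (positive_cone le))
    (Y : normedModType R) (T : {linear X -> Y}) :
  order_to_norm_bounded le T -> continuous T.
Proof.
move=> Tb.
have cC := positive_cone_convex Hle.
have [M M0 dec] := closed_generating_decomposition cC Hclosed Hgen.
have [L L0 TL] := order_to_norm_bounded_on_cone Hle Hclosed Tb.
apply: bounded_linear_continuous; apply/linear_boundedP.
(* Each of [T a] and [T b] contributes at most [L * M] times the norm of [x]. *)
exists (2 * (L * M)); split; first exact: num_real.
move=> r /ltW ltr x; apply: (@le_trans _ _ (2 * (L * M) * `|x|)); last first.
  exact: ler_wpM2r.
have [a [b [Ca Cb am bm xab]]] := dec x.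
rewrite {1}xab linearB; apply: le_trans (ler_normB _ _) _.
have Ta_le := le_trans (TL _ Ca) (ler_wpM2l L0 am).
have Tb_le := le_trans (TL _ Cb) (ler_wpM2l L0 bm).
by rewrite -!mulrA; lra.
Qed.
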